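(* Let $p,q,r$ be non-zero rational numbers. Then there exists a real number $t$ such that $$\left|\left(\frac tp,\frac tq,\frac tr\right)-\Lambda\right|\ \ge\ 1+\frac15 .$$
   Context: $\Lambda\subset\mathbf{Z}^3$ is the lattice of integer triples $(a,b,c)$ with $a+b+c$ even. For $\mathbf{v}=(x,y,z)\in\mathbf{R}^3$, $|\mathbf{v}-\Lambda|=\min\{|x-a|+|y-b|+|z-c| : (a,b,c)\in\Lambda\}$ is the $\ell^1$-distance from $\mathbf{v}$ to $\Lambda$. *)

(* Defs.v *)
From mathcomp Require Import all_boot all_order all_algebra.
From mathcomp Require Import boolp classical_sets reals.
From mathcomp Require Import zify lra.

Set Implicit Arguments.
Unset Strict Implicit.
Unset Printing Implicit Defensive.

Import Order.TTheory GRing.Theory Num.Theory.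

Local Open Scope classical_set_scope.
Local Open Scope ring_scope.

Definition Lambda : set (int * int * int) :=
  [set w | let: (a, b, c) := w in (2 %| a + b + c)%Z].

Definition l1_dist (R : realType) (v : R * R * R) (w : int * int * int) : R :=
  let: (x, y, z) := v in let: (a, b, c) := w in
  `|x - a%:~R| + `|y - b%:~R| + `|z - c%:~R|.

(* [inf] is total; [dist_LambdaP] shows that here it is an actual minimum. *)
Definition dist_Lambda (R : realType) (v : R * R * R) : R :=
  inf [set l1_dist v w | w in Lambda].

Lemma l1_dist_argmin (R : realType) (v : R * R * R) :
  exists2 w, Lambda w & forall w', Lambda w' -> l1_dist v w <= l1_dist v w'.
Proof.
case: v => [[x y] z]; set v := (x, y, z).
have L0 : Lambda (0, 0, 0) by [].
set D := l1_dist v (0, 0, 0).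
have [K DK] : exists K : nat, 2 * D < K%:R.
  exists (Num.bound `|2 * D|); rewrite (le_lt_trans (ler_norm _))//.
  exact: archi_boundP (normr_ge0 _).
pose I := 'I_(K + K).+1.
pose f (i : I) : int := (i : nat)%:Z - K%:Z.
pose g (u : I * I * I) := (f u.1.1, f u.1.2, f u.2).
pose P (u : I * I * I) := (2 %| f u.1.1 + f u.1.2 + f u.2)%Z.
have fS (a : int) : `|a%:~R : R| <= 2 * D -> exists i, f i = a.
  move=> aD; have : `|a%:~R : R| < K%:R by exact: le_lt_trans DK.
  rewrite -intr_norm -[K%:R]/(K%:Z%:~R) ltr_int => aK.
  have iK : (absz (a + K%:Z)%R < (K + K).+1)%N by lia.
  by exists (Ordinal iK); rewrite /f /=; lia.
have near w : l1_dist v w <= D -> exists u, g u = w.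
  case: w => [[a b] c]; rewrite /D /v /l1_dist !subr0 => wD.
  have tri (s : R) (m : int) : `|m%:~R : R| <= `|s - m%:~R| + `|s|.
    by rewrite -[X in `|X| <= _](subKr s) [leRHS]addrC ler_normB.
  have n0 (s : R) := normr_ge0 s.
  have [|i fi] := fS a.
    rewrite /D /v /l1_dist !subr0.
    by have := tri x a; have := n0 (y - b%:~R); have := n0 (z - c%:~R);
       have := n0 y; have := n0 z; lra.
  have [|j fj] := fS b.
    rewrite /D /v /l1_dist !subr0.
    by have := tri y b; have := n0 (x - a%:~R); have := n0 (z - c%:~R);
       have := n0 x; have := n0 z; lra.
  have [|k fk] := fS c.
    rewrite /D /v /l1_dist !subr0.
    by have := tri z c; have := n0 (x - a%:~R); have := n0 (y - b%:~R);
       have := n0 x; have := n0 y; lra.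
  by exists (i, j, k); rewrite /g /= fi fj fk.
have [u0 gu0] := near (0, 0, 0) (lexx _).
have Pu0 : P u0 by move: L0; rewrite -gu0.
case: (Order.TotalTheory.arg_minP (fun u => l1_dist v (g u)) Pu0) => u Pu umin.
exists (g u) => // w Lw; have [/near[u' gu']|/ltW] := leP (l1_dist v w) D.
  by rewrite -gu' umin//; move: Lw; rewrite -gu'.
by apply: le_trans; rewrite /D -gu0 umin.
Qed.

Lemma dist_LambdaP (R : realType) (v : R * R * R) :
  (exists2 w, Lambda w & dist_Lambda v = l1_dist v w) /\
  (forall w, Lambda w -> dist_Lambda v <= l1_dist v w).
Proof.
have [w Lw wmin] := l1_dist_argmin v.
have lbw : lbound [set l1_dist v w' | w' in Lambda] (l1_dist v w).
  by move=> _ [w' Lw' <-]; exact: wmin.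
suff -> : dist_Lambda v = l1_dist v w by split=> //; exists w.
apply/eqP; rewrite eq_le; apply/andP; split.
  by apply: ge_inf; [exists (l1_dist v w)|exists w].
by apply: lb_le_inf => //; exists (l1_dist v w); exists w.
Qed.

(* Main.v *)
(** Let T be the set of points of the unit cube at l1-distance at least 6/5 from
    each of its four vertices in Lambda.  It is a tetrahedron, and the set to be
    hit is the union of the translates of T and -T by Lambda.  By symmetry the
    line is spanned by (a, b, c) with 0 < a <= b <= c, and it hits a translate of
    T or -T exactly when (a, b, c) lies in the cone over it.  Near the boundary
    of the region a <= b <= c infinitely many cones are needed, and there one
    argues by hand with the different speeds of the coordinates:
    - if c is large against b, put (x, y) in [1/3, 2/3]^2 modulo 1, then move z;
    - if a is small against b, and c not too close to b, put x, then y, then z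
      near 1/2 modulo 1;
    - if a is small against b and c is close to b, then x and z - y are slow
      against y + z, and one first places the pair (x, z - y).
    What remains is covered by finitely many cones over tetrahedra, which is
    checked by computation.  The constant 6/5 is optimal for the directions
    (1, 2, 3), (1, 3, 4), (1, 3, 6). *)

From Stdlib Require Import ZArith.
Require Import Defs.
From mathcomp Require Import all_boot all_order all_algebra.
From mathcomp Require Import boolp classical_sets reals.
From mathcomp Require Import zify ssrZ ring lra.

Import Order.TTheory GRing.Theory Num.Theory.
Local Open Scope ring_scope.

(** * Directions close to the boundary *)

Section Avoidance.
Variable R : realType.
Implicit Types (a b c t x y z : R).

(* The translate by [(i, j, k)] of T.  The translates of -T are reached through
   the symmetry [t -> - t] of the line. *)
Definition in_tetra x y z (i j k : int) : Prop :=
  [/\ (i + j + k)%:~R + 6 / 5 <= x + y + z,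
      (i - j - k)%:~R - 4 / 5 <= x - y - z,
      (j - i - k)%:~R - 4 / 5 <= y - x - z
    & (k - i - j)%:~R - 4 / 5 <= z - x - y].

Definition far x y z : Prop :=
  exists i j k : int, (2 %| i + j + k)%Z /\ in_tetra x y z i j k.

Definition line_far a b c : Prop := exists t, far (t * a) (t * b) (t * c).

(** The l1 norm dominates every signed sum of coordinates. For the difference of the two lattice
    points, the four signed sums of [in_tetra] are even and add up to 0, so the first is <= 0 or
    another is <= -2; that face then gives 6/5. *)
Lemma far_dist x y z (w : int * int * int) :
  far x y z -> Lambda w -> 6 / 5 <= l1_dist (x, y, z) w.
Proof.
move: w => [[m1 m2] m3] [i [j [k [eijk [h0 h1 h2 h3]]]]] /= em.
have l1_ge s1 s2 s3 : `|s1| <= 1 -> `|s2| <= 1 -> `|s3| <= 1 ->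
    s1 * (x - m1%:~R) + s2 * (y - m2%:~R) + s3 * (z - m3%:~R) <=
    `|x - m1%:~R| + `|y - m2%:~R| + `|z - m3%:~R|.
  have le1 (s u : R) : `|s| <= 1 -> s * u <= `|u|.
    by move=> s1le; apply: le_trans (ler_norm _) _; rewrite normrM ler_piMl.
  by move=> H1 H2 H3; rewrite !lerD// le1.
have n1 : `|1 : R| <= 1 by rewrite normr1.
have nN1 : `|-1 : R| <= 1 by rewrite normrN1.
have [H|H] := leP (m1 + m2 + m3 - (i + j + k)) 0.
  apply: le_trans (l1_ge 1 1 1 n1 n1 n1).
  have := H; rewrite -(ler_int R); move: h0.
  by rewrite !(rmorphD, rmorphB, rmorphN) /=; lra.
have [H1|H1] := leP (m1 - m2 - m3 - (i - j - k)) (-2).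
  apply: le_trans (l1_ge 1 (-1) (-1) n1 nN1 nN1).
  have := H1; rewrite -(ler_int R); move: h1.
  by rewrite !(rmorphD, rmorphB, rmorphN) /=; lra.
have [H2|H2] := leP (m2 - m1 - m3 - (j - i - k)) (-2).
  apply: le_trans (l1_ge (-1) 1 (-1) nN1 n1 nN1).
  have := H2; rewrite -(ler_int R); move: h2.
  by rewrite !(rmorphD, rmorphB, rmorphN) /=; lra.
have H3 : m3 - m1 - m2 - (k - i - j) <= -2 by lia.
apply: le_trans (l1_ge (-1) (-1) 1 nN1 nN1 n1).
have := H3; rewrite -(ler_int R); move: h3.
by rewrite !(rmorphD, rmorphB, rmorphN) /=; lra.
Qed.

(** T contains the l1-ball of radius 3/10 about the centre of the cube. If [j + k] is odd, the cube
    carries a translate of -T, and [- t] is used. *)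
Lemma line_far_center a b c t (j k : int) :
  `|t * a - 1 / 2| + `|t * b - j%:~R - 1 / 2| + `|t * c - k%:~R - 1 / 2| <= 3 / 10 ->
  line_far a b c.
Proof.
move=> h.
have nb (u : R) : u <= `|u| /\ - u <= `|u|.
  by split; [exact: ler_norm | rewrite -normrN ler_norm].
move: h (nb (t * a - 1 / 2)) (nb (t * b - j%:~R - 1 / 2))
  (nb (t * c - k%:~R - 1 / 2)).
move: `|_| `|_| `|_| => A B C h [A1 A2] [B1 B2] [C1 C2].
have [e|e] := boolP (2 %| j + k)%Z.
  exists t, 0, j, k; split; first by rewrite add0r.
  by split; rewrite !(rmorphD, rmorphB, rmorphN) /=; lra.
exists (- t), (-1), (- j - 1), (- k - 1); split; first by clear -e; lia.
by split; rewrite !(rmorphD, rmorphB, rmorphN) /= !mulNr; lra.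
Qed.

Lemma nearest_int x : exists n : int, `|x - n%:~R| <= 1 / 2.
Proof.
exists (Num.floor (x + 1 / 2)).
have /andP[] := floor_itv (x + 1 / 2).
by rewrite intrD => h1 h2; rewrite ler_norml; lra.
Qed.

Lemma nearest_int_parity x (e : int) :
  exists n : int, (2 %| n - e)%Z /\ `|x - n%:~R| <= 1.
Proof.
have [m hm] := nearest_int ((x - e%:~R) / 2).
exists (e + 2 * m); split; first by lia.
by move: hm; rewrite intrD intrM !ler_norml; lra.
Qed.

(** If b <= 2a, the time 1/(a + b) works. Otherwise start at x = 1/3: there y >= 2/3, and y needs to
    advance by at most 2/3, so x at most doubles. *)
Lemma two_runners a b : 0 < a -> a <= b -> exists t (j : int),
  [/\ 1 / 3 <= t * a <= 2 / 3 & j%:~R + 1 / 3 <= t * b <= j%:~R + 2 / 3].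
Proof.
move=> a0 ab; have [h|h] := leP b (2 * a).
  have ab0 : 0 < a + b by lra.
  exists (a + b)^-1, 0; have e : (a + b)^-1 * a + (a + b)^-1 * b = 1.
    by rewrite -mulrDr mulVf// gt_eqF.
  have h1 : (a + b)^-1 * a <= (a + b)^-1 * b by rewrite ler_pM2l// invr_gt0.
  have h2 : (a + b)^-1 * b <= (a + b)^-1 * (2 * a).
    by rewrite ler_pM2l// invr_gt0.
  by split; lra.
have b0 : 0 < b by lra.
pose y0 := b / (3 * a).
have y0g : 2 / 3 <= y0 by rewrite /y0 ler_pdivlMr; lra.
pose j := - Num.floor (2 / 3 - y0).
have /andP[j1 j2] := floor_itv (2 / 3 - y0).
have {j1 j2} [j1 j2] : y0 <= j%:~R + 2 / 3 /\ j%:~R - 1 / 3 < y0.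
  by move: j1 j2; rewrite /j intrD rmorphN /=; lra.
have ta u : u / b * b = u by rewrite divfK// gt_eqF.
have y0a : y0 / b * a = 1 / 3 by rewrite /y0; field; lra.
have ab0 : 0 < a / b by rewrite divr_gt0.
have [hy|hy] := leP (j%:~R + 1 / 3) y0.
  by exists (y0 / b), j; rewrite ta y0a; lra.
exists ((j%:~R + 1 / 3) / b), j; rewrite ta; split; last by lra.
have -> : (j%:~R + 1 / 3) / b * a = (j%:~R + 1 / 3) * (a / b) by ring.
have e : y0 * (a / b) = 1 / 3 by rewrite -y0a; ring.
have h1 : y0 * (a / b) <= (j%:~R + 1 / 3) * (a / b) by rewrite ler_pM2r// ltW.
have h2 : (j%:~R + 1 / 3) * (a / b) <= (2 * y0) * (a / b).
  by rewrite ler_pM2r//; lra.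
by lra.
Qed.

Lemma line_far_fast_c a b c :
  0 < a -> a <= b -> 15 * b <= c -> line_far a b c.
Proof.
move=> a0 ab bc; have [t0 [j [hx hy]]] := two_runners _ _ a0 ab.
have b0 : 0 < b by lra.
have c0 : 0 < c by lra.
set x := t0 * a in hx; set y := t0 * b in hy; set y' := y - j%:~R.
(* Midpoint of the vertical segment of T over (x, y'). Its half-length is at least 2/15, which
   absorbs a drift of 1/15 in each of x and y. *)
pose z := 1 / 2 + (`|x + y' - 1| - `|x - y'|) / 2.
have [k [ek hk]] := nearest_int_parity (t0 * c - z) (- j).
pose w := (t0 * c - z) - k%:~R; pose s := - (w / c).
have sb : `|s * b| <= 1 / 15.
  rewrite /s mulNr normrN normrM normf_div (gtr0_norm c0) (gtr0_norm b0).
  rewrite -mulrA (mulrC c^-1) ; have : b / c <= 1 / 15.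
    by rewrite ler_pdivrMr //; lra.
  have : 0 <= b / c by rewrite divr_ge0// ltW.
  by rewrite -/w in hk; move: hk (normr_ge0 w); move: `|w| (b / c) => u v; nra.
have sab : exists u, [/\ 0 <= u, u <= 1 & s * a = u * (s * b)].
  exists (a / b); split; first by rewrite divr_ge0// ltW.
    by rewrite ler_pdivrMr// mul1r.
  by field; lra.
have sc : s * c = - w by rewrite /s mulNr divfK// gt_eqF.
exists (t0 + s), 0, j, k; split; first by clear -ek; lia.
rewrite !mulrDl -/x -/y sc; move: sab => [u [u0 u1 ->]].
move: sb; rewrite ler_norml; move: (s * b) => B /andP[B1 B2].
have [uB1 uB2 uB3] : [/\ u * B <= 1 / 15, - (1 / 15) <= u * B
    & - (1 / 15) <= u * B - B <= 1 / 15].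
  by split; [nra|nra|apply/andP; split; nra].
have tc : t0 * c = w + z + k%:~R by rewrite /w; ring.
have ey : y = y' + j%:~R by rewrite /y' subrK.
have hy' : 1 / 3 <= y' <= 2 / 3 by rewrite /y'; lra.
move: uB1 uB2 uB3; move: (u * B) => A uB1 uB2 uB3.
by split; rewrite !(rmorphD, rmorphB, rmorphN) /= tc ey /z;
  have [?|?] := ger0P (x + y' - 1); have [?|?] := ger0P (x - y'); lra.
Qed.

(* Take [x = 1/2], then the nearest time with [y = 1/2] modulo 1, then the nearest
   time with [z = 1/2] modulo 1. *)
Lemma line_far_middle a b c al be : 0 < a -> 0 < b -> 0 < c ->
  a <= al * b -> b <= be * c -> al * (1 + be) + be <= 3 / 5 -> line_far a b c.
Proof.
move=> a0 b0 c0 hal hbe hab.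
have [j hj] := nearest_int (1 / (2 * a) * b - 1 / 2).
move: hj; set et := (X in `|X|) => hj.
have et_def : et = 1 / (2 * a) * b - 1 / 2 - j%:~R by [].
pose t1 := 1 / (2 * a) - et / b; clearbody et.
have [k hk] := nearest_int (t1 * c - 1 / 2).
move: hk; set ze := (X in `|X|) => hk.
have ze_def : ze = t1 * c - 1 / 2 - k%:~R by [].
pose t := t1 - ze / c; clearbody ze.
have ab0 : 0 <= a / b by rewrite divr_ge0// ltW.
have bc0 : 0 <= b / c by rewrite divr_ge0// ltW.
have ab1 : a / b <= al by rewrite ler_pdivrMr.
have bc1 : b / c <= be by rewrite ler_pdivrMr.
have hc : t * c - k%:~R - 1 / 2 = 0.
  have -> : t * c = t1 * c - ze by rewrite /t mulrBl divfK// gt_eqF.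
  by rewrite ze_def; ring.
have hb : t * b - j%:~R - 1 / 2 = - (b / c) * ze.
  have -> : t * b = 1 / (2 * a) * b - et - ze * (b / c).
    by rewrite /t /t1; field; rewrite !gt_eqF.
  by rewrite et_def; ring.
have ha : t * a - 1 / 2 = - (a / b) * (et + (b / c) * ze).
  by rewrite /t /t1; field; rewrite !gt_eqF.
apply: (@line_far_center _ _ _ t j k).
rewrite hc hb ha normr0 addr0 !mulNr !normrN.
rewrite [`|a / b * _|]normrM (ger0_norm ab0).
rewrite [`|b / c * _|]normrM (ger0_norm bc0).
have := ler_normD et (b / c * ze).
rewrite [`|b / c * _|]normrM (ger0_norm bc0).
move: (normr_ge0 et) (normr_ge0 ze) (normr_ge0 (et + b / c * ze)) hj hk.
move: `|et| `|ze| `|et + _| => E Z W E0 Z0 W0 hj hk hW.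
(* The errors left in y and x; by the hypothesis on [al] and [be] they add up to at most 3/10. *)
have h1 : b / c * Z <= be / 2 by nra.
have h2 : a / b * W <= al * ((1 + be) / 2) by apply: ler_pM => //; lra.
by lra.
Qed.

(* Near time [t], the fast coordinate [y + z] is moved towards the centre [n + 1]
   (modulo 2) of its target interval, until its distance [w] to the centre, which
   is at most 1, is reduced to [r * w]. *)
Lemma line_far_fast_sum a b c t (i n : int) (r : R) :
  0 < a -> 0 < b -> b <= c -> 0 <= r <= 1 -> (2 %| i + n)%Z ->
  1 / 5 + r + (1 - r) * (a / (b + c)) <= t * a - i%:~R ->
  `|t * (c - b) - n%:~R| + (t * a - i%:~R) <=
    4 / 5 - (1 - r) * ((a + (c - b)) / (b + c)) ->
  line_far a b c.
Proof.
move=> a0 b0 bc /andP[r0 r1] ein h1 h2.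
have U0 : 0 < b + c by lra.
have [m [em hm]] := nearest_int_parity (t * (b + c)) (n + 1).
move: hm; set w := (X in `|X|) => hm.
have wE : t * (b + c) = m%:~R + w by rewrite /w; ring.
pose j := ((m - 1 - n) %/ 2)%Z.
have mE : m = n + 2 * j + 1 by rewrite /j; clear -em; lia.
pose s := - ((1 - r) * w / (b + c)).
have sE u : s * u = - w * ((1 - r) * (u / (b + c))) by rewrite /s; ring.
(* T is given by |y + z - 1| <= x - 1/5 and |z - y| <= 4/5 - x. At this corner the centre for y + z
   is 2j + n + 1 = m. *)
exists (t + s), i, j, (j + n); split; first by clear -ein; lia.
have ADE : (1 - r) * ((a + (c - b)) / (b + c)) =
  (1 - r) * (a / (b + c)) + (1 - r) * ((c - b) / (b + c)) by ring.
move: h1 h2; rewrite ADE {ADE}.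
have: s * (b + c) = - w * (1 - r) by rewrite sE divff ?gt_eqF// mulr1.
have: 0 <= (1 - r) * (a / (b + c)) by rewrite mulr_ge0 ?divr_ge0//; lra.
have: 0 <= (1 - r) * ((c - b) / (b + c)) by rewrite mulr_ge0 ?divr_ge0//; lra.
have := sE a; have := sE (c - b).
move: ((1 - r) * (a / (b + c))) ((1 - r) * ((c - b) / (b + c))) => A D.
clearbody s w; move=> sD sa D0 A0 sU h1 h2.
move: hm; rewrite ler_norml => /andP[w1 w2].
have [wD1 wD2] : w * D <= D /\ - D <= w * D by split; nra.
have [wA1 wA2] : w * A <= A /\ - A <= w * A by split; nra.
have [wr1 wr2] : w * r <= r /\ - r <= w * r by split; nra.
have nb (u : R) : u <= `|u| /\ - u <= `|u|.
  by split; [exact: ler_norm | rewrite -normrN ler_norm].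
move: h2 (nb (t * (c - b) - n%:~R)); move: `|_| => V h2 [V1 V2].
rewrite !mulrDl; move: wE sU sD sa V1 V2; rewrite mE !mulrDr !mulrN !mulNr.
move: (w * r) (w * A) (w * D) wr1 wr2 wA1 wA2 wD1 wD2.
move=> wr wA wD wr1 wr2 wA1 wA2 wD1 wD2 wE sU sD sa V1 V2.
by split; move: wE V1 V2 h1 h2;
  rewrite !(rmorphD, rmorphB, rmorphN, rmorphM) /=; lra.
Qed.

Lemma line_far_slow_a a b c :
  0 < a -> b <= c -> 30 * a <= b -> c <= 15 / 8 * b -> line_far a b c.
Proof.
move=> a0 bc ab cb; have b0 : 0 < b by lra.
have U0 : 0 < b + c by lra.
have Une : b + c != 0 by rewrite gt_eqF.
have ane : a != 0 by rewrite gt_eqF.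
pose K := (c - b) / a; have K0 : 0 <= K by rewrite divr_ge0//; lra.
have KE : c - b = K * a by rewrite /K divfK.
pose e := a / (b + c); have e0 : 0 < e by rewrite divr_gt0.
have eK : (a + (c - b)) / (b + c) = (1 + K) * e by rewrite KE /e; ring.
have eU : (60 + K) * e <= 1.
  have -> : (60 + K) * e = (60 * a + (c - b)) / (b + c) by rewrite KE /e; ring.
  by rewrite ler_pdivrMr//; lra.
have tK t : t / a * (c - b) = t * K by rewrite KE (mulrC K) mulrA divfK.
have nb (u v : R) : u <= v -> - u <= v -> `|u| <= v.
  by move=> h1 h2; rewrite ler_norml h1 andbT lerNl.
(* When x = t a, z - y equals K x. As K grows, the target for z - y is 0, then -1, then 2, then up
   to sign an integer near K/2. *)
have [K2|K2] := leP K 2.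
  apply: (@line_far_fast_sum _ _ _ (1 / 4 / a) 0 0 0) => //; first by lra.
    by rewrite divfK// -/e; nra.
  rewrite divfK// tK eK ger0_norm; last by rewrite subr0; lra.
  by nra.
have K10 : K + 1 != 0 by rewrite gt_eqF//; lra.
have [K3|K3] := leP K (7 / 2).
  (* At x = -u one branch of the absolute value gives 2 - u(K + 1) = 7/10; the other, u(K - 1), is
     largest at K = 7/2. *)
  pose u := 13 / 10 / (K + 1); have uE : u * (K + 1) = 13 / 10 by rewrite /u divfK.
  have u1 : 13 / 45 <= u <= 13 / 30 by apply/andP; split; nra.
  have e1 : (1 + K) * e <= 1 / 14 by nra.
  apply: (@line_far_fast_sum _ _ _ (- u / a) (-1) (-1) 0) => //; first by lra.
    by rewrite divfK// -/e; nra.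
  rewrite divfK// tK eK -lerBrDr; apply: nb; lra.
have [K4|K4] := leP K 10.
  pose u := 13 / 5 / (K + 1); have uE : u * (K + 1) = 13 / 5 by rewrite /u divfK.
  have u1 : 13 / 55 <= u <= 26 / 45 by apply/andP; split; nra.
  have e1 : (1 + K) * e <= 1 / 6 by nra.
  apply: (@line_far_fast_sum _ _ _ (u / a) 0 2 0) => //; first by lra.
    by rewrite divfK// -/e; nra.
  rewrite divfK// tK eK -lerBrDr; apply: nb; lra.
(* At x = n/K, close to 1/2, z - y is exactly n. For odd n the opposite time has the right
   parity. *)
have [n hn] := nearest_int (K / 2).
have Kne : K != 0 by rewrite gt_eqF//; lra.
pose x := n%:~R / K; have xE : x * K = n%:~R by rewrite /x divfK.
have x1 : 9 / 20 <= x <= 11 / 20.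
  by move: hn; rewrite -xE ler_norml => /andP[? ?]; apply/andP; split; nra.
have Ke : K * e <= 7 / 23.
  have -> : K * e = (c - b) / (b + c) by rewrite KE /e; ring.
  by rewrite ler_pdivrMr//; lra.
have e1 : e <= 1 / 70 by nra.
have [en|en] := boolP (2 %| n)%Z.
  apply: (@line_far_fast_sum _ _ _ (x / a) 0 n (7 / 30)) => //; first by lra.
  - by rewrite add0r.
  - by rewrite divfK// -/e; lra.
  by rewrite divfK// tK eK xE subrr normr0; lra.
apply: (@line_far_fast_sum _ _ _ (- x / a) (-1) (- n) (7 / 30)) => //.
- by lra.
- by clear -en; lia.
- by rewrite divfK// -/e; lra.
by rewrite divfK// tK eK mulNr xE rmorphN subrr normr0; lra.
Qed.

End Avoidance.

Arguments line_far {R} a b c.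

(** * The remaining directions *)

Notation zvec := (Z * Z * Z)%type.
Notation triangle := (zvec * zvec * zvec)%type.

(** * Integer computation: bisecting triangles of directions *)

Section Checker.
Local Open Scope Z_scope.

Definition zdot (l v : zvec) : Z :=
  let: (l1, l2, l3) := l in let: (a, b, c) := v in l1 * a + l2 * b + l3 * c.

Definition zcomb (x : Z) (v : zvec) (y : Z) (w : zvec) : zvec :=
  let: (a, b, c) := v in let: (a', b', c') := w in
  (x * a + y * a', x * b + y * b', x * c + y * c').

Definition zscale (x : Z) (v : zvec) : zvec :=
  let: (a, b, c) := v in (x * a, x * b, x * c).

(* A point [v] lies in the translate of T by [w] when
   [zdot l v >= zdot l w + e / 5] for all [(l, e)] in [faces]. *)
Definition faces : seq (zvec * Z) :=
  [:: ((1, 1, 1), 6); ((1, -1, -1), -4); ((-1, 1, -1), -4); ((-1, -1, 1), -4)].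

(* Cones [{v | zdot l v >= 0 for all l}] covered by the previous section. *)
Definition easy_cones : seq (seq zvec) :=
  [:: [:: (0, -15, 1)]; [:: (0, -3, 1); (-5, 1, 0)];
      [:: (0, -15, 8); (-30, 1, 0)]; [:: (0, 15, -8); (-30, 1, 0)]].

(* The far points of the unit cube with lowest corner [q] form the translate of
   [s * T] by [s * w], where [(s, w) = even_corner q]. *)
Definition even_corner (q : zvec) : Z * zvec :=
  let: (i, j, k) := q in
  if Z.even (i + j + k) then (1, q) else (-1, (- i - 1, - j - 1, - k - 1)).

(* If [(n, d) = ratio w v], then [n / (5 * d)] is the first time at which the ray
   through [v] can be in the translate of T by [w].  Nothing about [ratio] has to
   be proved, since [in_cone] tests the result. *)
Definition ratio (w v : zvec) : Z * Z :=
  foldl (fun nd f =>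
    let: (l, e) := f in let: (n, d) := nd in
    let s := zdot l v in let r := 5 * zdot l w + e in
    if 0 <? s then if n * s <? r * d then (r, s) else nd else nd)
  (0, 1) faces.

Definition in_cone (w v : zvec) : bool :=
  let: (n, d) := ratio w v in
  if 0 <? n then if 0 <=? d then
    all (fun f => let: (l, e) := f in
      d * (5 * zdot l w + e) <=? n * zdot l v) faces
  else false else false.

Definition cone_contains (q : zvec) (t : triangle) : bool :=
  let: (p1, p2, p3) := t in let: (s, w) := even_corner q in
  if in_cone w (zscale s p1) then
    if in_cone w (zscale s p2) then in_cone w (zscale s p3) else false
  else false.

(** The cube met at height k + 1/2 by the ray through the centroid of the triangle, its vertices
    being scaled to equal third coordinate. *)
Definition ray_cube (t : triangle) (k : Z) : zvec :=
  let: (p1, p2, p3) := t in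
  let: (a, b, c) :=
    zcomb (p3.2) (zcomb (p2.2) p1 (p1.2) p2) (p1.2 * p2.2) p3 in
  ((2 * k + 1) * a / (2 * c), (2 * k + 1) * b / (2 * c), k).

Fixpoint ray_hits (n : nat) (k : Z) (t : triangle) : bool :=
  if n is n'.+1 then
    if cone_contains (ray_cube t k) t then true else ray_hits n' (k + 1) t
  else false.

Definition easy (t : triangle) : bool :=
  let: (p1, p2, p3) := t in
  has (fun L => all (fun l =>
    [&& 0 <=? zdot l p1, 0 <=? zdot l p2 & 0 <=? zdot l p3]) L) easy_cones.

Definition primitive (v : zvec) : zvec :=
  let: (a, b, c) := v in let g := Z.gcd (Z.gcd a b) c in (a / g, b / g, c / g).

Definition split_edge (x y : Z) (t : triangle) : triangle * triangle :=
  let: (p, q, r) := t in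
  let m := primitive (zcomb x p y q) in ((p, m, r), (m, q, r)).

Definition rot (t : triangle) : triangle :=
  let: (p, q, r) := t in (q, r, p).

(** Newest-vertex bisection: the rotations bring the edge opposite the new vertex to the front, to
    be split next. The weights [q.2] and [p.2] give the midpoint in the chart where the third
    coordinate is 1. *)
Fixpoint covered (n : nat) (t : triangle) : bool :=
  if easy t then true else
  if ray_hits 40 0 t then true else
  if n is n'.+1 then
    let: (p, q, r) := t in
    if 0 <? p.2 then if 0 <? q.2 then
      let: (t1, t2) := split_edge q.2 p.2 t in
      if covered n' (rot (rot t1)) then covered n' (rot t2) else false
    else false else false
  else false.

Definition cut_edge (l : zvec) (t : triangle) : seq triangle :=
  let: (p, q, r) := t in
  let x := zdot l p in let y := zdot l q in
  if x * y <? 0 then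
    (* As x and y have opposite signs, these weights put the new vertex on the plane of [l]. *)
    let: (t1, t2) := split_edge (Z.abs y) (Z.abs x) t in [:: rot t1; rot t2]
  else [:: rot t].

(* [cut_edge] also rotates, so that three passes treat all the edges. *)
Definition cut (l : zvec) (ts : seq triangle) : seq triangle :=
  iter 3 (fun ts => flatten (map (cut_edge l) ts)) ts.

(* At each of the extremal directions (1, 2, 3), (1, 3, 4), (1, 3, 6), two cones
   over tetrahedra touch along one of the first three planes, and no cone contains
   a neighbourhood of the direction, so bisection alone would not terminate.  The
   last plane is the common boundary of two of the [easy_cones]. *)
Definition walls : seq zvec := [:: (5, -1, -1); (3, -5, 3); (3, 5, -3); (0, 15, -8)].

Definition pieces : seq triangle :=
  foldl (fun ts l => cut l ts) [:: ((0, 0, 1), (0, 1, 1), (1, 1, 1))] walls.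

Lemma pieces_covered : all (covered 16) pieces.
Proof. by vm_compute. Qed.
End Checker.

(** * Soundness of the computation for real directions *)

Section Soundness.
Variable R : realType.
Implicit Types (a b c : R).
Local Open Scope ring_scope.
Local Arguments Z.add : simpl never.
Local Arguments Z.mul : simpl never.

Definition zr (n : Z) : R := (int_of_Z n)%:~R.

Lemma zrD m n : zr (Z.add m n) = zr m + zr n.
Proof. by rewrite /zr -rmorphD /= -rmorphD. Qed.

Lemma zrM m n : zr (Z.mul m n) = zr m * zr n.
Proof. by rewrite /zr -rmorphM /= -rmorphM. Qed.

Lemma zr_ge0 n : Z.leb Z0 n -> 0 <= zr n.
Proof. by move=> h; rewrite /zr ler0z; lia. Qed.

Lemma zr_gt0 n : Z.ltb Z0 n -> 0 < zr n.
Proof. by move=> h; rewrite /zr ltr0z; lia. Qed.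

Lemma ler_zr m n : Z.leb m n -> zr m <= zr n.
Proof. by move=> h; rewrite /zr ler_int; lia. Qed.

Definition rdot (l : zvec) (a b c : R) : R :=
  let: (l1, l2, l3) := l in zr l1 * a + zr l2 * b + zr l3 * c.

(* [(a, b, c) = x p + y q + z r] with nonnegative [x, y, z], tested on integer
   linear forms. *)
Definition in_hull (t : triangle) (a b c : R) : Prop :=
  let: (p, q, r) := t in exists x y z : R, [/\ 0 <= x, 0 <= y, 0 <= z &
    forall l, rdot l a b c =
      x * zr (zdot l p) + y * zr (zdot l q) + z * zr (zdot l r)].

Lemma zdot_comb l x p y q :
  zr (zdot l (zcomb x p y q)) = zr x * zr (zdot l p) + zr y * zr (zdot l q).
Proof.
case: l p q => [[l1 l2] l3] [[a b] c] [[a' b'] c'] /=.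
by rewrite !(zrD, zrM); ring.
Qed.

Lemma zdot_scale l x p : zr (zdot l (zscale x p)) = zr x * zr (zdot l p).
Proof.
by case: l p => [[l1 l2] l3] [[a b] c] /=; rewrite !(zrD, zrM); ring.
Qed.

Lemma zdot_primitive v :
  exists2 g : R, 0 <= g & forall l, zr (zdot l v) = g * zr (zdot l (primitive v)).
Proof.
case: v => [[a b] c]; set g := Z.gcd (Z.gcd a b) c.
exists (zr g); first by apply: zr_ge0; apply/Z.leb_le; exact: Z.gcd_nonneg.
move=> [[l1 l2] l3]; rewrite /primitive -/g /zdot -zrM; congr zr.
have gE n : Z.divide g n -> n = Z.mul g (Z.div n g).
  case: (Z.eq_dec g Z0) => [->|g0] gn; first by case: gn; lia.
  by apply: Z_div_exact_full_2 => //; apply/Z.mod_divide.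
have ga : Z.divide g a.
  by apply: Z.divide_trans (Z.gcd_divide_l a b); exact: Z.gcd_divide_l.
have gb : Z.divide g b.
  by apply: Z.divide_trans (Z.gcd_divide_r a b); exact: Z.gcd_divide_l.
have gc : Z.divide g c by exact: Z.gcd_divide_r.
rewrite [in LHS](gE _ ga) [in LHS](gE _ gb) [in LHS](gE _ gc).
by clear; nia.
Qed.

Lemma split_edge_sound x y t a b c : Z.ltb Z0 x -> Z.ltb Z0 y -> in_hull t a b c ->
  in_hull (split_edge x y t).1 a b c \/ in_hull (split_edge x y t).2 a b c.
Proof.
case: t => [[p q] r] /zr_gt0 x0 /zr_gt0 y0 [al [be [ga [al0 be0 ga0 H]]]].
have [g g0 gE] := zdot_primitive (zcomb x p y q).
have gE' l : zr x * zr (zdot l p) + zr y * zr (zdot l q) =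
    g * zr (zdot l (primitive (zcomb x p y q))) by rewrite -zdot_comb.
rewrite /split_edge /=; move: gE'; move: (primitive _) => m gE'.
have [h|h] := leP (be * zr x) (al * zr y).
  left; exists (al - be / zr y * zr x), (be / zr y * g), ga; split => //.
  - by rewrite subr_ge0 mulrAC ler_pdivrMr.
  - by rewrite mulr_ge0// divr_ge0// ltW.
  by move=> l; rewrite H -(mulrA _ g) -gE'; field; rewrite gt_eqF.
right; exists (al / zr x * g), (be - al / zr x * zr y), ga; split => //.
- by rewrite mulr_ge0// divr_ge0// ltW.
- by rewrite subr_ge0 mulrAC ler_pdivrMr// ltW.
by move=> l; rewrite H -(mulrA _ g) -gE'; field; rewrite gt_eqF.
Qed.

Lemma rot_sound t a b c : in_hull t a b c -> in_hull (rot t) a b c.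
Proof.
case: t => [[p q] r] [x [y [z [x0 y0 z0 H]]]].
by exists y, z, x; split=> // l; rewrite H; ring.
Qed.

Lemma cut_edge_sound l t a b c : in_hull t a b c ->
  exists2 t', t' \in cut_edge l t & in_hull t' a b c.
Proof.
case: t => [[p q] r] H; rewrite /cut_edge.
case: ifP => [lt0|_]; last first.
  by exists (rot (p, q, r)); [exact: mem_head|exact: rot_sound].
have x0 : Z.ltb Z0 (Z.abs (zdot l q)).
  by apply/Z.ltb_lt/Z.abs_pos => e; rewrite e Z.mul_0_r in lt0.
have y0 : Z.ltb Z0 (Z.abs (zdot l p)).
  by apply/Z.ltb_lt/Z.abs_pos => e; rewrite e in lt0.
have [/rot_sound h|/rot_sound h] := split_edge_sound _ _ _ _ _ _ x0 y0 H.
  by exists (rot (split_edge (Z.abs (zdot l q)) (Z.abs (zdot l p)) (p, q, r)).1);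
    first exact: mem_head.
exists (rot (split_edge (Z.abs (zdot l q)) (Z.abs (zdot l p)) (p, q, r)).2) => //.
by rewrite in_cons mem_head orbT.
Qed.

Lemma cut_sound l ts a b c :
  (exists2 t, t \in ts & in_hull t a b c) ->
  exists2 t, t \in cut l ts & in_hull t a b c.
Proof.
move=> h; rewrite /cut; set m := (X in iter X).
elim: m => [//|n [t tts /(cut_edge_sound l)]] /=.
case=> t' t't ht'; exists t' => //; apply/flattenP.
by exists (cut_edge l t) => //; apply/mapP; exists t.
Qed.

Lemma pieces_sound a b c : 0 < a -> a <= b -> b <= c ->
  exists2 t, t \in pieces & in_hull t a b c.
Proof.
move=> a0 ab bc; rewrite /pieces; set t0 := (X in [:: X]).
have : exists2 t, t \in [:: t0] & in_hull t a b c.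
  exists t0; first exact: mem_head.
  exists (c - b), (b - a), a; split; try lra.
  have [z0 z1] : zr Z0 = 0 /\ zr (Zpos xH) = 1 by [].
  by move=> [[l1 l2] l3]; rewrite /zdot /rdot !(zrD, zrM) z0 z1; ring.
elim: walls [:: t0] => [//|l ls IH] ts h /=.
by apply: IH; exact: cut_sound.
Qed.

Lemma easy_sound t a b c : 0 < a -> a <= b -> b <= c ->
  easy t -> in_hull t a b c -> line_far a b c.
Proof.
case: t => [[p q] r] a0 ab bc /hasP[L Lin /allP Lall] [x [y [z [x0 y0 z0 H]]]].
have Lge l : l \in L -> 0 <= rdot l a b c.
  by move=> /Lall /and3P[? ? ?]; rewrite H !addr_ge0// mulr_ge0// zr_ge0.
have zrE : ((zr 0 = 0) * (zr 1 = 1) * (zr 8 = 8) * (zr 15 = 15) * (zr (-3) = -3) *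
  (zr (-5) = -5) * (zr (-8) = -8) * (zr (-15) = -15) * (zr (-30) = -30))%type.
  by [].
have mem2 (l1 l2 : zvec) : l2 \in [:: l1; l2] by rewrite in_cons mem_head orbT.
move: Lin; rewrite !inE => /or4P[] /eqP LE; move: Lge; rewrite {}LE => Lge.
- have := Lge _ (mem_head _ _); rewrite /= !zrE => h.
  by apply: line_far_fast_c => //; lra.
- have := Lge _ (mem_head _ _); have := Lge _ (mem2 _ _); rewrite /= !zrE => h1 h2.
  by apply: (@line_far_middle _ _ _ _ (1 / 5) (1 / 3)); lra.
- have := Lge _ (mem_head _ _); have := Lge _ (mem2 _ _); rewrite /= !zrE => h1 h2.
  by apply: (@line_far_middle _ _ _ _ (1 / 30) (8 / 15)); lra.
- have := Lge _ (mem_head _ _); have := Lge _ (mem2 _ _); rewrite /= !zrE => h1 h2.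
  by apply: line_far_slow_a; lra.
Qed.

Lemma in_coneP w v : in_cone w v -> exists2 k : R, 0 <= k &
  forall f, f \in faces -> k * (5 * zr (zdot f.1 w) + zr f.2) <= zr (zdot f.1 v).
Proof.
rewrite /in_cone; case: (ratio w v) => n d.
case: ifP => // /zr_gt0 n0; case: ifP => // /zr_ge0 d0 /allP H.
exists (zr d / zr n); first by rewrite divr_ge0// ltW.
move=> [l e] /H /ler_zr; rewrite !(zrM, zrD).
by rewrite mulrAC ler_pdivrMr// [zr (zdot l v) * _]mulrC.
Qed.

Lemma even_cornerP q : let: (s, (i, j, k)) := even_corner q in
  zr s ^+ 2 = 1 /\ (2 %| int_of_Z i + int_of_Z j + int_of_Z k)%Z.
Proof.
case: q => [[i j] k] /=; case: ifP => [/Z.even_spec e|/negbT e]; split.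
- by rewrite /zr /= expr1n.
- by case: e => m; lia.
- by rewrite /zr /= sqrrN expr1n.
- by rewrite Z.negb_even in e; case/Z.odd_spec: e => m; lia.
Qed.

(** The inequalities of [in_coneP] are linear in the inverse time [k] and the vector jointly, so
    those of the three generators add up. *)
Lemma cone_contains_sound q t a b c : 0 < a -> 0 < b -> 0 < c ->
  cone_contains q t -> in_hull t a b c -> line_far a b c.
Proof.
move=> a0 b0 c0; case: t => [[p1 p2] p3] /=; have := even_cornerP q.
case: (even_corner q) => s [[i j] k] [s2 ev].
case: ifP => // /in_coneP[k1 k10 h1]; case: ifP => // /in_coneP[k2 k20 h2].
move=> /in_coneP[k3 k30 h3] [x [y [z [x0 y0 z0 H]]]].
pose K := 5 * (x * k1 + y * k2 + z * k3).
have K0 : 0 <= K by rewrite mulr_ge0// !addr_ge0// mulr_ge0.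
have HK f : f \in faces ->
    K * (zr (zdot f.1 (i, j, k)) + zr f.2 / 5) <= zr s * rdot f.1 a b c.
  move=> fin; have := h1 f fin; have := h2 f fin; have := h3 f fin.
  rewrite !zdot_scale H => g3 g2 g1.
  have := ler_wpM2l x0 g1; have := ler_wpM2l y0 g2; have := ler_wpM2l z0 g3.
  by rewrite /K; lra.
have /allP := HK.
rewrite /= !(zrD, zrM).
have [-> -> -> ->] : [/\ zr 1 = 1, zr (-1) = -1, zr 6 = 6 & zr (-4) = -4] by [].
move=> /and5P[f0 f1 f2 f3 _].
(* The four face forms sum to 0; for K = 0 all would be nonnegative, hence zero, forcing a = 0. *)
have {}K0 : 0 < K.
  rewrite lt_def K0 andbT; apply/eqP => K00; move: f3 f2 f1 f0.
  rewrite K00 !mul0r => f3 f2 f1 f0.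
  have : zr s * a = 0 by lra.
  by move/eqP; rewrite mulf_eq0 => /orP[]/eqP e; [move: s2; rewrite e|]; lra.
exists (zr s / K), (int_of_Z i), (int_of_Z j), (int_of_Z k); split=> //.
have mK u v : K * u <= v -> u <= v / K by rewrite ler_pdivlMr// mulrC.
have := mK _ _ f0; have := mK _ _ f1; have := mK _ _ f2; have := mK _ _ f3.
move=> g3 g2 g1 g0; split; rewrite !(rmorphB, rmorphD) /=;
  by rewrite -/(zr i) -/(zr j) -/(zr k); lra.
Qed.

Lemma ray_hits_sound n k t a b c : 0 < a -> 0 < b -> 0 < c ->
  ray_hits n k t -> in_hull t a b c -> line_far a b c.
Proof.
move=> a0 b0 c0; elim: n k => [//|n IH] k /=; case: ifP => [+ _|_]; last exact: IH.
exact: cone_contains_sound.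
Qed.

Local Arguments ray_hits : simpl never.
Local Arguments easy : simpl never.

Lemma covered_sound n t a b c : 0 < a -> a <= b -> b <= c ->
  covered n t -> in_hull t a b c -> line_far a b c.
Proof.
move=> a0 ab bc; have b0 : 0 < b by lra.
have c0 : 0 < c by lra.
elim: n t => [|n IH] t /=; case: ifP => [te _|_]; try exact: easy_sound.
  by case: ifP => // th _; exact: ray_hits_sound th.
case: ifP => [th _|_]; first exact: ray_hits_sound th.
case: t => [[p q] r]; case: ifP => // p0; case: ifP => // q0.
case: ifP => // H1 H2 /(split_edge_sound _ _ _ _ _ _ q0 p0)[] h.
  by apply: (IH _ H1); do 2 apply: rot_sound.
by apply: (IH _ H2); exact: rot_sound.
Qed.

Lemma line_far_sorted a b c : 0 < a -> a <= b -> b <= c -> line_far a b c.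
Proof.
move=> a0 ab bc; have [t tin] := pieces_sound _ _ _ a0 ab bc.
by apply: (covered_sound 16) => //; exact: (allP pieces_covered).
Qed.

End Soundness.

(** * Signs and order of the coordinates *)

Definition avoids (R : realType) (a b c : R) : Prop :=
  exists t : R, forall w, Lambda w -> 6 / 5 <= l1_dist (t * a, t * b, t * c) w.

Lemma avoids_swap12 (R : realType) (a b c : R) : avoids R a b c -> avoids R b a c.
Proof.
move=> [t ht]; exists t => -[[m1 m2] m3] Lw.
rewrite /= [`|_| + `|_|]addrC; apply: (ht (m2, m1, m3)).
by move: Lw; rewrite /Lambda /= [m1 + m2]addrC.
Qed.

Lemma avoids_swap23 (R : realType) (a b c : R) : avoids R a b c -> avoids R a c b.
Proof.
move=> [t ht]; exists t => -[[m1 m2] m3] Lw.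
rewrite /= addrAC; apply: (ht (m1, m3, m2)).
by move: Lw; rewrite /Lambda /= addrAC.
Qed.

Lemma avoids_opp (R : realType) (a b c : R) : avoids R a b c -> avoids R (- a) b c.
Proof.
move=> [t ht]; exists t => -[[m1 m2] m3] Lw.
have e : `|t * - a - m1%:~R| = `|t * a - (- m1)%:~R|.
  by rewrite mulrN rmorphN /= -normrN opprB opprK addrC opprK.
rewrite /= e; apply: (ht (- m1, m2, m3)).
by move: Lw; rewrite /Lambda /=; lia.
Qed.

Lemma avoids_norm (R : realType) (a b c : R) : avoids R `|a| b c -> avoids R a b c.
Proof. by have [_|_] := ger0P a => // /avoids_opp; rewrite opprK. Qed.

Lemma avoids_sorted (R : realType) (a b c : R) :
  0 < a -> a <= b -> b <= c -> avoids R a b c.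
Proof.
move=> a0 ab bc; have [t ht] := line_far_sorted _ _ _ _ a0 ab bc.
by exists t => w; exact: far_dist.
Qed.

Lemma avoids_pos (R : realType) (a b c : R) :
  0 < a -> 0 < b -> 0 < c -> avoids R a b c.
Proof.
move=> a0 b0 c0; have s := @avoids_sorted R.
have [ab|/ltW ab] := leP a b; have [bc|/ltW bc] := leP b c;
  have [ac|/ltW ac] := leP a c.
- exact: s.
- by apply: s => //; exact: le_trans ab bc.
- by apply: avoids_swap23; exact: s.
- by apply: avoids_swap23; apply: avoids_swap12; exact: s.
- by apply: avoids_swap12; exact: s.
- by apply: avoids_swap12; apply: avoids_swap23; exact: s.
- by apply: avoids_swap12; apply: avoids_swap23; apply: avoids_swap12;
    apply: s => //; exact: le_trans bc ab.
- by apply: avoids_swap12; apply: avoids_swap23; apply: avoids_swap12; exact: s.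
Qed.

Lemma avoids_neq0 (R : realType) (a b c : R) :
  a != 0 -> b != 0 -> c != 0 -> avoids R a b c.
Proof.
rewrite -!normr_gt0 => a0 b0 c0; apply/avoids_norm/avoids_swap12/avoids_norm.
apply/avoids_swap23/avoids_swap12/avoids_norm; exact: avoids_pos.
Qed.

Theorem theorem4 (R : realType) (p q r : rat)
    (hp : p != 0) (hq : q != 0) (hr : r != 0) :
  exists t : R,
    dist_Lambda (t / ratr p, t / ratr q, t / ratr r) >= 1 + 1 / 5.
Proof.
have ratrV_neq0 (x : rat) : x != 0 -> (ratr x : R)^-1 != 0.
  by move=> x0; rewrite invr_eq0 fmorph_eq0.
have [t ht] := @avoids_neq0 R _ _ _ (ratrV_neq0 _ hp) (ratrV_neq0 _ hq)
  (ratrV_neq0 _ hr).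
exists t; have [[w Lw ->] _] := dist_LambdaP (t / ratr p, t / ratr q, t / ratr r).
by have := ht w Lw; lra.
Qed.
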